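(* Let $k,m,n$ be positive integers with $k\le m\le n$, and let $\mathrm{C1}(k,m,n)$, $\mathrm{C2}(k,m,n)$, $\mathrm{C3}(k,m,n)$ be the assertions defined in the context. Then $\mathrm{C3}(k,m,n)$ implies $\mathrm{C2}(k,m,n)$, and $\mathrm{C2}(k,m,n)$ implies $\mathrm{C1}(k,m,n)$.
   Context: Notation: $[m]=\{1,\dots,m\}$. A $k$-assignment of a matrix $X$ is a set of $k$ entries of $X$, no two in the same row or column; its value is the sum of its entries; $\min_k(X)$ is the minimum value of a $k$-assignment, and a minimum $k$-assignment is one attaining this value (the $0$-assignment is empty, with value $0$). A random exponential matrix with rate matrix $A=(a_{ij})$ (positive entries) is a random matrix $X=(x_{ij})$ with independent entries, $x_{ij}$ having density $a_{ij}e^{-a_{ij}x}$ on $x\ge 0$. $\mathrm{C1}(k,m,n)$: if $X$ is a random exponential $m\times n$ matrix with all rates equal to $1$, then $$E(\min\nolimits_k(X))=\sum_{i,j\ge 0,\ i+j<k}\frac{1}{(m-i)(n-j)}.$$ $\mathrm{C2}(k,m,n)$: for all positive reals $r_1,\dots,r_m$ and $c_1,\dots,c_n$, if $X$ is a random exponential $m\times n$ matrix with rate matrix $(r_ic_j)$, then $$E(\min\nolimits_k(X))=\sum_{I,J}(-1)^{k-1-|I|-|J|}\binom{m+n-1-|I|-|J|}{k-1-|I|-|J|}\frac{1}{\left(\sum_{i\notin I}r_i\right)\left(\sum_{j\notin J}c_j\right)},$$ the sum being over proper subsets $I\subsetneq[m]$ and $J\subsetneq[n]$ with $|I|+|J|<k$.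 $\mathrm{C3}(k,m,n)$: for all positive reals $r_1,\dots,r_m$ and $c_1,\dots,c_n$, all $I\subseteq[m]$ and $J\subseteq[n]$ with $|I|=|J|=k-1$, if $X$ is a random exponential $m\times n$ matrix with rate matrix $(r_ic_j)$, $M$ is the $(k-1)\times(k-1)$ submatrix of $X$ with rows indexed by $I$ and columns indexed by $J$, and $\chi_M(X)$ equals $1$ if $M$ contains a minimum $(k-1)$-assignment of $X$ and $0$ otherwise, then $E(\chi_M(X)\cdot\min_k(X))$ equals $$\sum_{i,j}\left(\prod_{t=1}^{k-1}\frac{r_{i_t}c_{j_t}}{\left(R-\sum_{s=1}^{t-1}r_{i_s}\right)\left(C-\sum_{s=1}^{t-1}c_{j_s}\right)}\right)\sum_{t,u\ge 0,\ t+u<k}\frac{1}{\left(R-\sum_{s=1}^{t}r_{i_s}\right)\left(C-\sum_{s=1}^{u}c_{j_s}\right)},$$ where the outer sum is over permutations (orderings) $(i_1,\dots,i_{k-1})$ of $I$ and $(j_1,\dots,j_{k-1})$ of $J$, and $R=\sum_{i=1}^m r_i$, $C=\sum_{j=1}^n c_j$. *)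

(* Defs.v *)
From HB Require Import structures.
From mathcomp Require Import all_boot all_order all_algebra.
From mathcomp Require Import all_classical all_reals all_analysis.

Set Implicit Arguments.
Unset Strict Implicit.
Unset Printing Implicit Defensive.

Import Order.TTheory GRing.Theory Num.Theory.

Local Open Scope ring_scope.

Section Assignments.
Context {R : realType} {m n : nat}.
Implicit Types (X : 'M[R]_(m, n)) (S : {set 'I_m * 'I_n}).

Definition is_assignment (k : nat) S : bool :=
  (#|S| == k) &&
  [forall e in S, forall f in S,
     (e != f) ==> (e.1 != f.1) && (e.2 != f.2)].

Definition assignment_value X S : R := \sum_(e in S) X e.1 e.2.

(* The [pick] only supplies the starting point that [arg min] requires. When
   k <= minn m n a k-assignment exists, and this is the least value of one
   (lemma [min_assignmentP] below). *)
Definition min_assignment (k : nat) X : R :=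
  let S0 := odflt finset.set0 [pick S | is_assignment k S] in
  assignment_value X
    [arg min_(S < S0 | is_assignment k S) assignment_value X S]%O.

Definition is_min_assignment (k : nat) X S : bool :=
  is_assignment k S && (assignment_value X S == min_assignment k X).

(* The submatrix with row set I and column set J is represented by its set of
   positions. *)
Definition chi (k : nat) (I : {set 'I_m}) (J : {set 'I_n}) X : R :=
  [exists S : {set 'I_m * 'I_n},
     is_min_assignment k X S && (S \subset finset.setX I J)]%:R.

Lemma min_assignmentP (k : nat) X : (k <= m)%N -> (k <= n)%N ->
  (exists2 S, is_assignment k S & assignment_value X S = min_assignment k X) /\
  (forall S, is_assignment k S -> min_assignment k X <= assignment_value X S).
Proof.
move=> km kn; rewrite /min_assignment.
case: pickP => [S0 S0k /=|noS].
  case: arg_minP => // S Sk minS; split=> [|S' S'k]; first by exists S.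
  exact: minS.
pose f (t : 'I_k) := (widen_ord km t, widen_ord kn t).
have f_inj : injective f.
  by move=> s t /(congr1 (fun e => val e.1)) /= /val_inj.
have := noS (f @: 'I_k).
rewrite /is_assignment card_imset // card_ord eqxx /= => /negbT/negP[].
apply/'forall_implyP => _ /imsetP[s _ ->].
apply/'forall_implyP => _ /imsetP[t _ ->].
by apply/implyP; rewrite (inj_eq f_inj) /= -!val_eqE /= => ->.
Qed.

End Assignments.

Section RandomExponentialMatrix.
Context {d : measure_display} {T : measurableType d} {R : realType}.
Context (P : probability T R).

Definition mutually_independent (I : finType) (X : I -> {RV P >-> R}) : Prop :=
  forall (J : {set I}) (B : I -> set R), (forall i, measurable (B i)) ->
    P (\bigcap_(i in [set` J]) (X i @^-1` B i))%classic =
    (\prod_(i in J) P (X i @^-1` B i)%classic)%E.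

Record random_exponential {m n : nat} (A : 'M[R]_(m, n))
    (X : 'I_m -> 'I_n -> {RV P >-> R}) : Prop := RandomExponential {
  _ : forall i j, 0 < A i j;
  _ : forall i j (B : set R), measurable B ->
        distribution P (X i j) B = exponential_prob (A i j) B;
  _ : mutually_independent (fun e : 'I_m * 'I_n => X e.1 e.2)
}.

Definition realization {m n : nat} (X : 'I_m -> 'I_n -> {RV P >-> R}) (w : T) :
  'M[R]_(m, n) := \matrix_(i, j) X i j w.

End RandomExponentialMatrix.

Section Assertions.
Context (R : realType) (k m n : nat).

Definition C1 : Prop :=
  forall (d : measure_display) (T : measurableType d) (P : probability T R)
    (X : 'I_m -> 'I_n -> {RV P >-> R}),
  random_exponential (\matrix_(i < m, j < n) 1) X ->
  'E_P[fun w => min_assignment k (realization X w)]%E =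
  (\sum_(i < k) \sum_(j < k | (i + j < k)%N)
     ((m%:R - i%:R) * (n%:R - j%:R))^-1)%:E.

Definition C2 : Prop :=
  forall (r : 'I_m -> R) (c : 'I_n -> R),
  (forall i, 0 < r i) -> (forall j, 0 < c j) ->
  forall (d : measure_display) (T : measurableType d) (P : probability T R)
    (X : 'I_m -> 'I_n -> {RV P >-> R}),
  random_exponential (\matrix_(i < m, j < n) (r i * c j)) X ->
  'E_P[fun w => min_assignment k (realization X w)]%E =
  (\sum_(I : {set 'I_m} | I \proper 'I_m)
   \sum_(J : {set 'I_n} | (J \proper 'I_n) && (#|I| + #|J| < k)%N)
     (-1) ^+ (k - 1 - #|I| - #|J|)
     * 'C(m + n - 1 - #|I| - #|J|, k - 1 - #|I| - #|J|)%:R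
     * ((\sum_(i | i \notin I) r i) * (\sum_(j | j \notin J) c j))^-1)%:E.

(* Total minus the sum of the weights of the first t entries of s. *)
Definition rest (p : nat) (a : 'I_p -> R) (s : seq 'I_p) (t : nat) : R :=
  \sum_i a i - \sum_(x <- take t s) a x.

Definition is_ordering (p q : nat) (I : {set 'I_p}) (s : q.-tuple 'I_p) : bool :=
  uniq s && ([set x in s]%SET == I).

(* The product over t runs over 0 <= t < k - 1, one less than the customary
   1-based position, so [tnth i t] is the entry following the t entries that
   [rest r i t] removes. *)
Definition C3 : Prop :=
  forall (r : 'I_m -> R) (c : 'I_n -> R),
  (forall i, 0 < r i) -> (forall j, 0 < c j) ->
  forall (I : {set 'I_m}) (J : {set 'I_n}),
  #|I| = (k - 1)%N -> #|J| = (k - 1)%N ->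
  forall (d : measure_display) (T : measurableType d) (P : probability T R)
    (X : 'I_m -> 'I_n -> {RV P >-> R}),
  random_exponential (\matrix_(i < m, j < n) (r i * c j)) X ->
  'E_P[fun w => (chi (k - 1) I J (realization X w)
                 * min_assignment k (realization X w))%R]%E =
  (\sum_(i : (k - 1).-tuple 'I_m | is_ordering I i)
   \sum_(j : (k - 1).-tuple 'I_n | is_ordering J j)
     (\prod_(t < k - 1)
        (r (tnth i t) * c (tnth j t) / (rest r i t * rest c j t)))
     * \sum_(t < k) \sum_(u < k | (t + u < k)%N)
         (rest r i t * rest c j u)^-1)%:E.

End Assertions.

(* Main.v *)
Require Import Defs.
From mathcomp Require Import all_boot all_order all_algebra.
From mathcomp Require Import all_classical all_reals all_analysis.
From mathcomp Require Import measurable_realfun.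
From mathcomp Require Import ring lra zify.

(** Size-biased sampling without replacement is the order of death of
    independent exponential clocks with rates r_i. The part of the C3 sum that
    depends on r and t is therefore the expectation of 1 / (rate left after t
    deaths), that is the mean length of the period with exactly m - t
    survivors, and inclusion-exclusion turns it into an alternating sum over
    subsets. Multiplying the row and column factors and applying Vandermonde's
    identity gives the coefficients of C2; for unit rates each factor is
    1 / (m - t), which gives C1.

    For C3 -> C2 the functions chi (k - 1) I J must sum to 1 almost surely,
    which holds as soon as no two assignments have the same value. A tie
    expresses some entry as a linear combination of the others; after rounding
    the others to a grid of mesh del this confines that entry to an interval of
    length O(del), so that bounded density and the product rule bound the
    probability of a tie by O(del). *)

Set Implicit Arguments.
Unset Strict Implicit.
Unset Printing Implicit Defensive.

Import Order.TTheory GRing.Theory Num.Theory.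

Local Open Scope ring_scope.

(** * Alternating binomial sums *)

Section BinomialSums.
Context {R : comRingType}.

Lemma sum_sign_bin (N K : nat) :
  \sum_(s < K.+1) (-1) ^+ s * 'C(N.+1, s)%:R = (-1) ^+ K * 'C(N, K)%:R :> R.
Proof.
elim: K => [|K IH]; first by rewrite big_ord_recr big_ord0 /= !bin0 add0r.
by rewrite big_ord_recr /= IH binS natrD exprS; ring.
Qed.

(** For fixed t, [sum_sign_bin] collapses the sum over u to a signed 'C(N, K - t). What remains is a
    Vandermonde convolution. *)
Lemma triangle_sum_sign_bin (M N K : nat) :
  \sum_(t < K.+1) \sum_(u < K.+1 - t)
    (-1) ^+ (t + u) * ('C(M, t) * 'C(N.+1, u))%:R
  = (-1) ^+ K * 'C(M + N, K)%:R :> R.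
Proof.
rewrite -binomial.Vandermonde natr_sum mulr_sumr.
apply: eq_bigr => -[t /=]; rewrite ltnS => le_tK _.
rewrite subSn // -[in X in _ ^+ X * _](subnKC le_tK) exprD natrM.
rewrite mulrACA -(sum_sign_bin N) mulr_sumr.
by apply: eq_bigr => u _; rewrite exprD natrM mulrACA.
Qed.

(** Pascal's rule, as the induction step for iterated differences. *)
Lemma sum_binS (a : nat) (F : nat -> R) :
  \sum_(s < a.+2) 'C(a.+1, s)%:R * F s
  = \sum_(s < a.+1) 'C(a, s)%:R * (F s + F s.+1).
Proof.
rewrite big_ord_recl; under eq_bigr => s _ do rewrite lift0 binS natrD mulrDl.
under [in RHS]eq_bigr => s _ do rewrite mulrDr.
rewrite !big_split addrA; congr (_ + _) => /=.
transitivity (\sum_(s < a.+2) 'C(a, s)%:R * F s).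
  by rewrite [RHS]big_ord_recl !bin0.
by rewrite big_ord_recr /= bin_small // mul0r addr0.
Qed.

(** An a-th difference annihilates 'C(s, p), a polynomial in s of degree p < a. Each [sum_binS] step
    takes one difference and lowers p by one. *)
Lemma sum_sign_bin_bin (a p : nat) : (p < a)%N ->
  \sum_(s < a.+1) 'C(a, s)%:R * ((-1) ^+ s * 'C(s, p)%:R) = 0 :> R.
Proof.
elim: a p => // a IH p; rewrite (sum_binS _ (fun s => (-1) ^+ s * 'C(s, p)%:R)).
case: p => [_|p ltpa].
  by apply: big1 => s _; rewrite !bin0 exprS; ring.
apply/eqP; rewrite -oppr_eq0 -sumrN; apply/eqP.
rewrite -[RHS](IH p ltpa).
apply: eq_bigr => s _; rewrite binS natrD exprS; ring.
Qed.

Lemma sum_subsets_card (T : finType) (A : {set T}) (F : nat -> R) :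
  \sum_(S : {set T} | S \subset A) F #|S|
  = \sum_(s < #|A|.+1) 'C(#|A|, s)%:R * F s.
Proof.
rewrite (partition_big (fun S : {set T} => inord #|S| : 'I_#|A|.+1) xpredT) //.
apply: eq_bigr => s _.
rewrite -cards_draws -[X in X%:R]sum1_card natr_sum mulr_suml.
apply: eq_big => S; rewrite ?inE.
  case SA: (S \subset A) => //=.
  by rewrite -val_eqE /= inordK // ltnS subset_leq_card.
by case/andP=> SA /eqP <-; rewrite inordK ?mul1r // ltnS subset_leq_card.
Qed.

End BinomialSums.

(** * Size-biased sampling and the survival times of exponential clocks *)

Section SizeBiasedSampling.
Context {R : numFieldType} {T : finType}.
Implicit Types (r : T -> R) (A S : {set T}).

(* If the elements of A die at independent exponential times with rates r, this
   is the expected time during which exactly p of them are alive: the integral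
   of the inclusion-exclusion formula for the probability of that event. *)
Definition survival_time r A (p : nat) : R :=
  \sum_(S : {set T} | S \subset A)
    (-1) ^+ (#|S| + p) * 'C(#|S|, p)%:R / \sum_(i in S) r i.

(** Relative to a set [A], so that inductions can delete the first sampled element from it. *)
Definition rest_in r A (s : seq T) (t : nat) : R :=
  \sum_(i in A) r i - \sum_(x <- take t s) r x.

(** For duplicate-free [s] in [A], the probability that the first deaths in [A] occur in the order
    [s]. The default 0 of [nth] is never reached. *)
Definition sample_weight r A (s : seq T) : R :=
  \prod_(j < size s) (nth 0 (map r s) j / rest_in r A s j).

Lemma weight_neq0 r A : (forall i, 0 < r i) -> (0 < #|A|)%N ->
  \sum_(i in A) r i != 0.
Proof.
move=> r_gt0 /card_gt0P[x xA]; rewrite (bigD1 x) //=.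
by rewrite lt0r_neq0 // ltr_wpDr // sumr_ge0 // => i _; apply: ltW.
Qed.

Lemma survival_time_all r A : survival_time r A #|A| = (\sum_(i in A) r i)^-1.
Proof.
rewrite /survival_time (bigD1 A) //= binn mulr1 addnn -mul2n exprM.
rewrite sqrrN !expr1n.
rewrite div1r [X in _ + X]big1 ?addr0 // => S /andP[SA neSA].
by rewrite bin_small ?mulr0 ?mul0r // proper_card // finset.properEneq neSA.
Qed.

(** Conditioning on the first death, which for p < |A| precedes the period with p survivors.
    Algebraically, the i in [A] outside a subset S have total rate r(A) - r(S). *)
Lemma survival_time_rec r A p :
  (forall i, 0 < r i) -> (0 < p)%N -> (p < #|A|)%N ->
  (\sum_(i in A) r i) * survival_time r A p
  = \sum_(i in A) r i * survival_time r (A :\ i) p.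
Proof.
move=> r_gt0 p_gt0 ltpA; rewrite /survival_time.
under [RHS]eq_bigr => i _ do rewrite mulr_sumr.
rewrite (exchange_big_dep (fun S : {set T} => S \subset A)) /=; last first.
  by move=> i S _ /fintype.subset_trans; apply; apply: finset.subsetDl.
pose c (S : {set T}) : R := (-1) ^+ (#|S| + p) * 'C(#|S|, p)%:R.
(* The subtracted coefficients [c S] sum to 0 by [sum_sign_bin_bin]. With them the identity holds
   for each S separately. *)
have <- : \sum_(S : {set T} | S \subset A)
    ((\sum_(i in A) r i) * (c S / \sum_(i in S) r i) - c S) =
    (\sum_(i in A) r i) *
       (\sum_(S : {set T} | S \subset A) c S / (\sum_(i in S) r i)).
  rewrite big_split /= -mulr_sumr -[RHS]addr0; congr (_ + _).
  rewrite sumrN /c; under eq_bigr => S _ do rewrite exprD mulrAC mulrC.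
  rewrite -mulr_sumr (sum_subsets_card A (fun s => (-1) ^+ s * 'C(s, p)%:R)).
  by rewrite sum_sign_bin_bin // mulr0 oppr0.
apply: eq_bigr => S SA; rewrite -/(c S) -mulr_suml.
(* The empty set has weight 0, but its coefficient 'C(0, p) vanishes because p > 0. *)
have [S0|S0] := posnP #|S|.
  by rewrite /c S0 bin_small // mulr0 !mul0r !mulr0 subr0.
have wS := weight_neq0 r_gt0 S0.
rewrite (bigID (mem S)) /=.
have -> : \sum_(i in A | i \in S) r i = \sum_(i in S) r i.
  apply: eq_bigl => i; case: (boolP (i \in S)) => iS; last by rewrite andbF.
  by rewrite (fintype.subsetP SA).
have -> : \sum_(i in A | i \notin S) r i
    = \sum_(i in A | S \subset A :\ i) r i.
  apply: eq_bigl => i; congr (_ && _); by rewrite finset.subsetD1 SA.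
by field.
Qed.

(** Among p survivors of rate 1 the next death comes at rate p. The recursion averages over the
    first death, so the value at |A| = p persists for larger sets. *)
Lemma survival_time_const A p : (0 < p)%N -> (p <= #|A|)%N ->
  survival_time (fun=> 1) A p = p%:R^-1.
Proof.
move=> p_gt0; elim: {A}_.+1 {-2}A (ltnSn #|A|) => // a IH A leAa.
rewrite leq_eqVlt => /predU1P[->|ltpA].
  by rewrite survival_time_all sumr_const.
have A0 : #|A|%:R != 0 :> R by rewrite pnatr_eq0; lia.
apply: (mulfI A0).
have := @survival_time_rec (fun=> 1) A p (fun=> ltr01) p_gt0 ltpA.
rewrite sumr_const => ->; rewrite mulr_natl -sumr_const.
apply: eq_bigr => i iA; rewrite mul1r; have := cardsD1 i A; rewrite iA => cA.
by apply: IH; lia.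
Qed.

Lemma sum_uniq_tupleS A q (F : seq T -> R) :
  \sum_(s : q.+1.-tuple T | uniq s && all (mem A) s) F s
  = \sum_(x in A) \sum_(s : q.-tuple T | uniq s && all (mem (A :\ x)) s)
      F (x :: s).
Proof.
rewrite pair_big_dep /=.
rewrite (reindex (fun xs : T * q.-tuple T => [tuple of xs.1 :: xs.2])) /=;
  last first.
  exists (fun s : q.+1.-tuple T => (thead s, [tuple of behead s])).
    by case=> x s _; congr pair; apply: val_inj.
  by move=> s _; rewrite /= -tuple_eta.
apply: eq_bigl => -[x s] /=.
have -> : all (mem (A :\ x)) s = (x \notin tval s) && all (mem A) s.
  elim: (tval s) => //= y t ->; rewrite !inE negb_or.
  by rewrite (eq_sym y x); case: (x == y); case: (y \in A); case: (x \in t).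
by case: (x \in A); case: (x \notin tval s); case: (uniq s); rewrite //= ?andbF.
Qed.

Lemma rest_in0 r A s : rest_in r A s 0 = \sum_(i in A) r i.
Proof. by rewrite /rest_in take0 big_nil subr0. Qed.

Lemma rest_inS r A x s t : x \in A ->
  rest_in r A (x :: s) t.+1 = rest_in r (A :\ x) s t.
Proof.
by move=> xA; rewrite /rest_in /= big_cons (big_setD1 _ xA) /=; ring.
Qed.

Lemma sample_weight_cons r A x s : x \in A ->
  sample_weight r A (x :: s)
  = r x / (\sum_(i in A) r i) * sample_weight r (A :\ x) s.
Proof.
move=> xA; rewrite /sample_weight big_ord_recl rest_in0 /=; congr (_ * _).
by apply: eq_bigr => j _; rewrite rest_inS.
Qed.

(** The weights are the probabilities of the possible samples of size q; the induction conditions on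
    the first draw. *)
Lemma sum_sample_weight r A q : (forall i, 0 < r i) -> (q <= #|A|)%N ->
  \sum_(s : q.-tuple T | uniq s && all (mem A) s) sample_weight r A s = 1.
Proof.
move=> r_gt0; elim: q A => [|q IH] A leqA.
  rewrite (big_pred1 [tuple]) => [|s]; last by rewrite tuple0.
  by rewrite /sample_weight big_ord0.
have wA := weight_neq0 r_gt0 (leq_ltn_trans (leq0n _) leqA).
rewrite sum_uniq_tupleS -(divff wA) mulr_suml; apply: eq_bigr => x xA.
under eq_bigr => s _ do rewrite sample_weight_cons //.
by rewrite -mulr_sumr IH ?mulr1 //; move: leqA; rewrite (cardsD1 x A) xA.
Qed.

(** Both sides obey the first-death recursion of [survival_time_rec] and equal 1 / r(A) at t = 0. *)
Lemma sum_sample_weight_rest r A q t : (forall i, 0 < r i) ->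
  (t <= q)%N -> (q <= #|A|)%N -> (t < #|A|)%N ->
  \sum_(s : q.-tuple T | uniq s && all (mem A) s)
    sample_weight r A s / rest_in r A s t
  = survival_time r A (#|A| - t).
Proof.
move=> r_gt0; elim: t A q => [|t IH] A q letq leqA lttA.
  under eq_bigr => s _ do rewrite rest_in0.
  by rewrite -mulr_suml sum_sample_weight // subn0 survival_time_all mul1r.
case: q letq leqA => // q letq leqA.
rewrite (@sum_uniq_tupleS A q
  (fun s => sample_weight r A s / rest_in r A s t.+1)).
have wA := weight_neq0 r_gt0 (leq_ltn_trans (leq0n _) lttA).
apply: (mulfI wA); rewrite survival_time_rec //; [|lia|lia].
rewrite mulr_sumr; apply: eq_bigr => x xA.
have cA : #|A| = #|A :\ x|.+1 by rewrite (cardsD1 x A) xA.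
under [X in _ * X]eq_bigr => s _ do
  rewrite sample_weight_cons // rest_inS // -mulrA.
rewrite -mulr_sumr IH //; [|lia|lia].
by rewrite cA subSS mulrA mulrCA divff // mulr1.
Qed.

(** Passes from the set S of survivors to its complement I. The signs agree because the exponents
    differ by an even number, and I = T drops out since 'C(0, |T| - t) = 0. *)
Lemma survival_time_setT r t : (t < #|T|)%N ->
  survival_time r [set: T]%SET (#|T| - t)
  = \sum_(I : {set T} | I \proper T)
      (-1) ^+ (#|I| + t) * 'C(#|T| - #|I|, #|T| - t)%:R
      / \sum_(i | i \notin I) r i.
Proof.
move=> lttT; rewrite /survival_time.
rewrite (reindex_inj (inv_inj (@finset.setCK T))) /=.
under eq_bigl => I do rewrite finset.subsetT.
rewrite [RHS]big_mkcond /=; apply: eq_bigr => I _.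
have cI := cardsC I; rewrite properE subset_predT /=.
have cIC : (#|~: I| = #|T| - #|I|)%N by lia.
rewrite cIC; case: ifPn => [_|/negPn TI].
  congr (_ / _).
    congr (_ * _); rewrite -signr_odd -[RHS]signr_odd; congr (_ ^+ _).
    rewrite !oddD !oddB ?max_card // ?(ltnW lttT) //.
    by case: (odd #|T|); case: (odd #|I|); case: (odd t).
  by apply: eq_bigl => i; rewrite inE.
have -> : #|I| = #|T| by apply/eqP; rewrite eqn_leq max_card subset_leq_card.
by rewrite subnn bin_small ?mulr0 ?mul0r // subn_gt0.
Qed.

End SizeBiasedSampling.

(** * Discarding vanishing rows and columns from sums over a triangle *)

Section TriangleSums.
Context {V : nmodType}.
Implicit Types G : nat -> nat -> V.

Lemma triangle_sumE k G :
  \sum_(t < k) \sum_(u < k | (t + u < k)%N) G t u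
  = \sum_(t < k) \sum_(u < k - t) G t u.
Proof.
apply: eq_bigr => t _; rewrite (big_ord_widen k (G t) (leq_subr t k)).
by apply: eq_bigl => u; rewrite ltn_subRL.
Qed.

Lemma triangle_sum_shiftl a k G : (forall t u, (t < a)%N -> G t u = 0) ->
  \sum_(t < a + k) \sum_(u < a + k - t) G t u
  = \sum_(t < k) \sum_(u < k - t) G (a + t)%N u.
Proof.
move=> G0; elim: a k G G0 => // a IH k G G0.
rewrite addSn big_ord_recl big1 => [|u _]; last by rewrite G0.
rewrite add0r -(IH _ (fun t u => G t.+1 u)) //.
by move=> t u lta; apply: G0.
Qed.

Lemma triangle_sum_shiftr b k G : (forall t u, (u < b)%N -> G t u = 0) ->
  \sum_(t < b + k) \sum_(u < b + k - t) G t u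
  = \sum_(t < k) \sum_(u < k - t) G t (b + u)%N.
Proof.
move=> G0; elim: b k G G0 => // b IH k G G0.
(* The last row consists of the entry u = 0 alone, which vanishes; every other row then loses its
   first entry. *)
rewrite addSn big_ord_recr /= subSnn big_ord1 G0 // addr0.
rewrite -(IH _ (fun t u => G t u.+1)) => [|t u ltb]; last exact: G0.
apply: eq_bigr => -[t /= ltt] _; rewrite subSn ?(ltnW ltt) // big_ord_recl.
by rewrite G0 // add0r.
Qed.

End TriangleSums.

(** * From survival times to the coefficients of C2 *)

Section TriangleCoefficients.
Context {R : numFieldType}.

Lemma bin_sub_sub m a t : (t < m)%N ->
  'C(m - a, m - t) = (if (a <= t)%N then 'C(m - a, t - a) else 0%N).
Proof.
move=> lttm; case: leqP => leat; last by rewrite bin_small //; lia.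
by rewrite -bin_sub; [congr ('C(_, _)); lia|lia].
Qed.

(** Terms with t < a or u < b vanish. Shifting by a and b leaves a triangle of side k - a - b, which
    [triangle_sum_sign_bin] evaluates. *)
Lemma triangle_sum_bin_sub k m n a b : (k <= m)%N -> (k <= n)%N ->
  \sum_(t < k) \sum_(u < k | (t + u < k)%N)
     ((-1) ^+ (a + t) * 'C(m - a, m - t)%:R)
     * ((-1) ^+ (b + u) * 'C(n - b, n - u)%:R)
  = (if (a + b < k)%N then
       (-1) ^+ (k - 1 - a - b) * 'C(m + n - 1 - a - b, k - 1 - a - b)%:R
     else 0) :> R.
Proof.
move=> lekm lekn.
pose G t u : R :=
  ((-1) ^+ (a + t) * (if (a <= t)%N then 'C(m - a, t - a) else 0%N)%:R)
  * ((-1) ^+ (b + u) * (if (b <= u)%N then 'C(n - b, u - b) else 0%N)%:R).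
transitivity (\sum_(t < k) \sum_(u < k | (t + u < k)%N) G t u).
  apply: eq_bigr => t _; apply: eq_bigr => u _; rewrite !bin_sub_sub //.
    exact: leq_trans lekn.
  exact: leq_trans lekm.
have Gl t u : (t < a)%N -> G t u = 0.
  by move=> ltta; rewrite /G leqNgt ltta /= mulr0 mul0r.
have Gr t u : (u < b)%N -> G t u = 0.
  by move=> ltub; rewrite /G (leqNgt b) ltub /= !mulr0.
case: ltnP => [ltabk|leabk]; last first.
  apply: big1 => t _; apply: big1 => u ltk.
  have [ltta|leat] := ltnP t a; first exact: Gl.
  by apply: Gr; lia.
rewrite triangle_sumE.
have [K kE] : exists K, k = (a + (b + K.+1))%N by exists (k - 1 - a - b)%N; lia.
rewrite kE in lekm lekn *.
rewrite triangle_sum_shiftl //.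
rewrite (@triangle_sum_shiftr _ _ _ (fun t u => G (a + t)%N u)) => [|t u];
  last exact: Gr.
have -> : (a + (b + K.+1) - 1 - a - b)%N = K by lia.
(* The 1 subtracted from m + n arises because [triangle_sum_sign_bin] is applied with N.+1 = n - b,
   which is positive as b < k <= n. *)
have -> : (m + n - 1 - a - b)%N = (m - a + (n - b).-1)%N by lia.
rewrite -(triangle_sum_sign_bin _ _ K).
have -> : (n - b).-1.+1 = (n - b)%N by lia.
apply: eq_bigr => t _; apply: eq_bigr => u _.
rewrite /G !leq_addr !addKn natrM mulrACA -exprD.
have -> : (a + (a + t) + (b + (b + u)) = t + u + 2 * (a + b))%N by lia.
by rewrite [in LHS]exprD exprM sqrrN !expr1n mulr1.
Qed.

(** Expand both factors over sets I and J and exchange the sums; the coefficient of each pair is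
    then a sum over the triangle. *)
Lemma sum_survival_times k m n (r : 'I_m -> R) (c : 'I_n -> R) :
  (k <= m)%N -> (k <= n)%N ->
  \sum_(t < k) \sum_(u < k | (t + u < k)%N)
    survival_time r [set: 'I_m]%SET (m - t)
    * survival_time c [set: 'I_n]%SET (n - u)
  = \sum_(I : {set 'I_m} | I \proper 'I_m)
    \sum_(J : {set 'I_n} | (J \proper 'I_n) && (#|I| + #|J| < k)%N)
     (-1) ^+ (k - 1 - #|I| - #|J|)
     * 'C(m + n - 1 - #|I| - #|J|, k - 1 - #|I| - #|J|)%:R
     * ((\sum_(i | i \notin I) r i) * (\sum_(j | j \notin J) c j))^-1.
Proof.
move=> lekm lekn.
have Er (t : 'I_k) := @survival_time_setT R _ r t.
have Ec (t : 'I_k) := @survival_time_setT R _ c t.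
rewrite !card_ord in Er Ec.
under eq_bigr => t _ do under eq_bigr => u _ do
  rewrite Er ?(leq_trans _ lekm) // Ec ?(leq_trans _ lekn) // big_distrlr /=.
under eq_bigr => t _ do rewrite exchange_big /=.
rewrite exchange_big /=; apply: eq_bigr => I _.
under eq_bigr => t _ do rewrite exchange_big /=.
rewrite exchange_big /= [RHS]big_mkcondr /=; apply: eq_bigr => J _.
transitivity ((\sum_(t < k) \sum_(u < k | (t + u < k)%N)
     ((-1) ^+ (#|I| + t) * 'C(m - #|I|, m - t)%:R)
     * ((-1) ^+ (#|J| + u) * 'C(n - #|J|, n - u)%:R))
  * ((\sum_(i | i \notin I) r i) * (\sum_(j | j \notin J) c j))^-1).
  rewrite mulr_suml; apply: eq_bigr => t _; rewrite mulr_suml.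
  by apply: eq_bigr => u _; rewrite invfM mulrACA.
by rewrite triangle_sum_bin_sub //; case: ifP; rewrite ?mul0r.
Qed.


End TriangleCoefficients.

(** * The C3 sums over orderings as survival times *)

Lemma rest_in_setT (R : realType) p (a : 'I_p -> R) (s : seq 'I_p) t :
  rest_in a [set: 'I_p]%SET s t = rest a s t.
Proof. by rewrite /rest_in /rest; under eq_bigl => i do rewrite inE. Qed.

Lemma sample_weight_setT (R : realType) p q (a : 'I_p -> R)
    (s : q.-tuple 'I_p) :
  sample_weight a [set: 'I_p]%SET s = \prod_(t < q) (a (tnth s t) / rest a s t).
Proof.
rewrite /sample_weight size_tuple; apply: eq_bigr => t _.
rewrite rest_in_setT; have x0 := tnth s t.
by rewrite (nth_map x0) ?size_tuple // (tnth_nth x0).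
Qed.

Lemma sum_orderings (V : nmodType) p q (F : q.-tuple 'I_p -> V) :
  \sum_(I : {set 'I_p} | #|I| == q)
    \sum_(s : q.-tuple 'I_p | is_ordering I s) F s
  = \sum_(s : q.-tuple 'I_p | uniq s) F s.
Proof.
rewrite [RHS](partition_big (fun s : q.-tuple 'I_p => [set x in s]%SET)
  (fun I : {set 'I_p} => #|I| == q)) //= => s us.
by rewrite cardsE (card_uniqP us) size_tuple.
Qed.

(** Summing over I and J frees the orderings to be arbitrary duplicate-free tuples. For fixed t and
    u the summand splits into a row and a column factor, each evaluated by
    [sum_sample_weight_rest]. *)
Lemma sum_orderings_survival_times (R : realType) k m n
    (r : 'I_m -> R) (c : 'I_n -> R) :
  (0 < k)%N -> (k <= m)%N -> (k <= n)%N ->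
  (forall i, 0 < r i) -> (forall j, 0 < c j) ->
  \sum_(I : {set 'I_m} | #|I| == (k - 1)%N)
  \sum_(J : {set 'I_n} | #|J| == (k - 1)%N)
    \sum_(i : (k - 1).-tuple 'I_m | is_ordering I i)
    \sum_(j : (k - 1).-tuple 'I_n | is_ordering J j)
     (\prod_(t < (k - 1))
        (r (tnth i t) * c (tnth j t) / (rest r i t * rest c j t)))
     * \sum_(t < k) \sum_(u < k | (t + u < k)%N)
         (rest r i t * rest c j u)^-1
  = \sum_(t < k) \sum_(u < k | (t + u < k)%N)
      survival_time r [set: 'I_m]%SET (m - t)
      * survival_time c [set: 'I_n]%SET (n - u).
Proof.
move=> k_gt0 lekm lekn r_gt0 c_gt0.
under eq_bigr => I _ do rewrite exchange_big /=.
rewrite (sum_orderings (fun i => \sum_(J : {set 'I_n} | #|J| == (k - 1)%N) _)).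
under eq_bigr => i _ do rewrite (sum_orderings (fun j => _ * _)).
pose w (p : nat) (a : 'I_p -> R) := sample_weight a [set: 'I_p]%SET.
transitivity (\sum_(i : (k - 1).-tuple 'I_m | uniq i)
    \sum_(j : (k - 1).-tuple 'I_n | uniq j)
    \sum_(t < k) \sum_(u < k | (t + u < k)%N)
      (w m r i / rest_in r [set: 'I_m]%SET i t)
      * (w n c j / rest_in c [set: 'I_n]%SET j u)).
  apply: eq_bigr => i _; apply: eq_bigr => j _.
  rewrite mulr_sumr; apply: eq_bigr => t _; rewrite mulr_sumr.
  apply: eq_bigr => u _; rewrite !rest_in_setT mulrACA -invfM; congr (_ / _).
  rewrite /w !sample_weight_setT -big_split /=; apply: eq_bigr => s _.
  by rewrite invfM mulrACA.
under eq_bigr => i _ do rewrite exchange_big /=.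
rewrite exchange_big /=; apply: eq_bigr => t _.
under eq_bigr => i _ do rewrite exchange_big /=.
rewrite exchange_big /=; apply: eq_bigr => u _.
have total p (a : 'I_p -> R) (v : 'I_k) : (k <= p)%N -> (forall i, 0 < a i) ->
    \sum_(s : (k - 1).-tuple 'I_p | uniq s)
      w p a s / rest_in a [set: 'I_p]%SET s v
    = survival_time a [set: 'I_p]%SET (p - v).
  move=> lekp a_gt0; have ltvk := ltn_ord v.
  have := @sum_sample_weight_rest _ _ a [set: 'I_p]%SET (k - 1)%N v a_gt0.
  rewrite cardsT card_ord => <-; [|lia|lia|lia].
  apply: eq_bigl => s; rewrite [all _ _](_ : _ = true) ?andbT //.
  by apply/allP => x _; rewrite /= inE.
by rewrite -big_distrlr /= !total.
Qed.

Lemma sum_survival_times_const (R : realType) k m n :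
  (k <= m)%N -> (k <= n)%N ->
  \sum_(t < k) \sum_(u < k | (t + u < k)%N)
    survival_time (fun=> 1) [set: 'I_m]%SET (m - t)
    * survival_time (fun=> 1) [set: 'I_n]%SET (n - u)
  = \sum_(t < k) \sum_(u < k | (t + u < k)%N)
     ((m%:R - t%:R) * (n%:R - u%:R))^-1 :> R.
Proof.
move=> lekm lekn; apply: eq_bigr => t _; apply: eq_bigr => u _.
have ltt := ltn_ord t; have ltu := ltn_ord u.
by rewrite !survival_time_const ?cardsT ?card_ord -?invfM -?natrB //; lia.
Qed.

(** * Bounds from the exponential density *)

Section ExponentialLaw.
Context {R : realType}.
Implicit Types a x y : R.

Lemma exponential_pdf_le a x : 0 <= a -> exponential_pdf a x <= a.
Proof.
move=> a_ge0; have [x_lt0|x_ge0] := ltP x 0.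
  by rewrite lt0_exponential_pdf.
rewrite exponential_pdfE // ler_piMr // -expR0 ler_expR mulNr oppr_le0.
exact: mulr_ge0.
Qed.

Lemma exponential_prob_itv_le a x y : 0 < a -> x <= y ->
  (exponential_prob a `[x, y]%classic <= (a * (y - x))%:E)%E.
Proof.
move=> a_gt0 lexy.
apply: (@le_trans _ _
  (\int[lebesgue_measure]_(z in `[x, y]%classic) (cst a%:E) z)%E).
  apply: ge0_le_integral => //=.
  - by move=> z _; rewrite lee_fin exponential_pdf_ge0 // ltW.
  - apply/measurable_EFinP; apply: measurable_funTS.
    by apply: measurable_exponential_pdf; apply: ltW.
  - by move=> z _; rewrite lee_fin exponential_pdf_le // ltW.
rewrite integral_cst //= lebesgue_measure_itv /= lte_fin.
case: ltP => [_|leyx]; first by rewrite EFinM EFinB.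
by rewrite mule0 lee_fin mulr_ge0 ?subr_ge0 // ltW.
Qed.

Lemma exponential_prob_lt0 a : exponential_prob a `]-oo, 0%R[%classic = 0%E.
Proof.
apply: integral0_eq => x /=; rewrite in_itv /= => x_lt0.
by rewrite lt0_exponential_pdf.
Qed.

End ExponentialLaw.

(** * Linear ties between independent variables *)

Section Ties.
Context {d : measure_display} {T : measurableType d} {R : realType}.
Context (P : probability T R).

(** A bound on all conditional probabilities given [g], summed over the countably many fibers. The
    product form covers fibers of probability 0. *)
Lemma probability_le_fibers (g : T -> nat) (A : set T) (eps : R) :
  measurable A -> (forall n, measurable (g @^-1` [set n])%classic) ->
  (forall n, P (A `&` g @^-1` [set n])%classic
             <= eps%:E * P (g @^-1` [set n])%classic)%E ->
  (P A <= eps%:E)%E.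
Proof.
move=> mA mg leP.
have cover : (\bigcup_n (g @^-1` [set n]) = setT)%classic.
  by apply/seteqP; split=> // w _; exists (g w).
have tg : trivIset setT (fun n => g @^-1` [set n])%classic.
  by move=> i j _ _ [w [/= -> ->]].
apply: le_trans (measure_sigma_subadditive P
  (F := fun n => A `&` g @^-1` [set n])%classic _ mA _) _.
- by move=> n; apply: measurableI.
- by rewrite -setI_bigcupr cover setIT.
apply: le_trans (lee_nneseries _ (fun n _ => leP n)) _.
  by move=> n _ _; apply: measure_ge0.
rewrite nneseriesZl => [|n _]; last exact: measure_ge0.
rewrite -[leRHS]mule1 -(@probability_setT _ _ _ P) -cover measure_bigcup //.
by under [in leRHS]eq_eseriesl => n do rewrite in_setT.
Qed.

Context {I : finType} (X : I -> {RV P >-> R}).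
Hypothesis indepX : mutually_independent X.

(** The product rule is used for all indices and for all but [e], with one family [B'] that takes
    the value [U] at [e]. *)
Lemma mutually_independentD1 (e : I) (U : set R) (B : I -> set R) :
  measurable U -> (forall f, measurable (B f)) ->
  P (X e @^-1` U `&` \bigcap_(f in [set f | f != e]) (X f @^-1` B f))%classic
  = (P (X e @^-1` U)%classic
     * P (\bigcap_(f in [set f | f != e]) (X f @^-1` B f))%classic)%E.
Proof.
move=> mU mB; pose B' f := if f == e then U else B f.
have mB' f : measurable (B' f) by rewrite /B'; case: ifP.
have BB' f : f != e -> B' f = B f by rewrite /B' => /negbTE ->.
have B'e : B' e = U by rewrite /B' eqxx.
have eqD1 : (\bigcap_(f in [set f | f != e]) (X f @^-1` B f)
    = \bigcap_(f in [set` [set~ e]%SET]) (X f @^-1` B' f))%classic.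
  apply/seteqP; split=> w Bw f /=; rewrite ?inE => fe.
    by rewrite BB' //; apply: Bw.
  by rewrite -BB' //; apply: Bw; rewrite /= !inE.
have -> : (X e @^-1` U `&` \bigcap_(f in [set f | f != e]) (X f @^-1` B f)
    = \bigcap_(f in [set` [set: I]%SET]) (X f @^-1` B' f))%classic.
  apply/seteqP; split=> w.
    case=> Uw Bw f _; have [->|fe] := eqVneq f e; first by rewrite B'e.
    by rewrite BB' //; apply: Bw.
  move=> B'w; split; first by rewrite -B'e; apply: B'w; rewrite /= inE.
  by move=> f /= fe; rewrite -BB' //; apply: B'w; rewrite /= inE.
rewrite eqD1 !indepX // [LHS](bigD1 e) ?inE //= B'e; congr (_ * _)%E.
by apply: eq_bigl => f; rewrite !inE.
Qed.

Lemma negligible_linear_tie (e : I) (z : I -> R) (C : R) :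
  0 <= C -> z e = 0 ->
  (forall x y, x <= y ->
     (P (X e @^-1` `[x, y]%classic)%classic <= (C * (y - x))%:E)%E) ->
  P.-negligible [set w | X e w = \sum_f z f * X f w]%classic.
Proof.
move=> C_ge0 ze0 P_itv; set A := (X in P.-negligible X).
have mA : measurable A.
  pose tie w := X e w == \sum_f z f * X f w.
  have -> : A = (tie @^-1` [set true])%classic.
    by apply/seteqP; split=> w /= /eqP.
  rewrite -[X in measurable X]setTI.
  suff mf : measurable_fun setT tie by exact: mf.
  apply: measurable_fun_eqr => //; apply: measurable_sum => f.
  exact: measurable_funM.
pose L := \sum_f `|z f|.
have L_ge0 : 0 <= L by apply: sumr_ge0.
suff leA (del : R) : 0 < del -> (P A <= (C * (L * del *+ 2))%:E)%E.
  apply/negligibleP => //; apply/eqP; rewrite -measure_le0.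
  apply/lee_addgt0Pr => eps eps_gt0.
  (* The added 1 keeps the denominator positive when C * L = 0. *)
  rewrite add0e; have K_gt0 : 0 < C * L *+ 2 + 1.
    by rewrite ltr_wpDl // mulrn_wge0 // mulr_ge0.
  apply: le_trans (leA (eps / (C * L *+ 2 + 1)) _) _; first exact: divr_gt0.
  rewrite lee_fin; set K := (X in _ / X).
  have -> : C * (L * (eps / K) *+ 2) = eps * ((C * L *+ 2) / K) by ring.
  by rewrite ler_piMr ?(ltW eps_gt0) // ler_pdivrMr // mul1r lerDl.
move=> del_gt0.
(* [W] records the grid cells of the variables other than [X e]; the constant 0 at [e] makes the
   fibers of [g] independent of [X e]. [pickle] makes [g] natural-valued. *)
pose W w := [ffun f => if f == e then 0 else Num.floor (X f w / del)].
pose g w := pickle (W w).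
pose B w0 f := [set x | Num.floor (x / del) = W w0 f]%classic.
have mB w0 f : measurable (B w0 f).
  have -> : B w0 f = `[(W w0 f)%:~R * del, (W w0 f + 1)%:~R * del[%classic.
    apply/seteqP; split=> x /=;
      rewrite in_itv /= -ler_pdivlMr // -ltr_pdivrMr //.
      by move/eqP; rewrite Num.Theory.floor_eq.
    by rewrite -Num.Theory.floor_eq => /eqP.
  exact: measurable_itv.
have fiberE w0 : (g @^-1` [set g w0]
    = \bigcap_(f in [set f | f != e]) (X f @^-1` B w0 f))%classic.
  apply/seteqP; split=> w.
    move=> /= /(pcan_inj pickleK) eqW f /= fe.
    by rewrite /B /= -eqW ffunE (negbTE fe).
  move=> Bw /=; congr pickle; apply/ffunP => f; rewrite !ffunE.
  have [//|fe] := eqVneq f e.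
  by have := Bw f fe; rewrite /B /= ffunE (negbTE fe).
have mfiber w0 : measurable (g @^-1` [set g w0])%classic.
  rewrite fiberE; apply: fin_bigcap_measurable => [|f _].
    exact: finite_finset.
  by rewrite -[X in measurable X]setTI; apply: measurable_funPT.
apply: (@probability_le_fibers g) => // n.
  have [[w0 <-]|no] := pselect (exists w0, g w0 = n); first exact: mfiber.
  rewrite (_ : (_ @^-1` _)%classic = set0) //.
  by apply/seteqP; split=> // w /= gw; case: no; exists w.
have [[w0 <-]|no] := pselect (exists w0, g w0 = n); last first.
  rewrite (_ : (_ @^-1` _)%classic = set0) ?setI0 ?measure0 ?mule0 //.
  by apply/seteqP; split=> // w /= gw; case: no; exists w.
(* The linear combination at the lower ends of the cells. On the fiber the other variables differ
   from these ends by at most [del], so a tie puts [X e] within L * del of [c]. *)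
pose c := \sum_f z f * ((W w0 f)%:~R * del).
pose U := `[c - L * del, c + L * del]%classic.
have mU : measurable U by exact: measurable_itv.
have mXU : measurable (X e @^-1` U)%classic.
  by rewrite -[X in measurable X]setTI; apply: measurable_funPT.
apply: (@le_trans _ _ (P (X e @^-1` U `&` g @^-1` [set g w0])%classic)).
  apply: le_measure; rewrite ?inE; [exact: measurableI|exact: measurableI|].
  rewrite fiberE => w [Aw Bw]; split=> //.
  rewrite /U /= in_itv /= -ler_distl Aw /c -sumrB /L mulr_suml.
  apply: le_trans (ler_norm_sum _ _ _) _; apply: ler_sum => f _.
  rewrite -mulrBr normrM; have [->|fe] := eqVneq f e.
    by rewrite ze0 normr0 !mul0r.
  rewrite ler_wpM2l // -(Bw f fe).
  have /andP[] := Num.Theory.floor_itv (X f w / del).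
  rewrite ler_pdivlMr // ltr_pdivrMr // intrD mulrDl mul1r => le1 lt2.
  by rewrite ler_distl; lra.
rewrite fiberE mutually_independentD1 //.
apply: lee_wpmul2r => //.
have Ldel : 0 <= L * del by rewrite mulr_ge0 // ltW.
apply: le_trans (P_itv _ _ _) _; first by lra.
by rewrite lee_fin ler_wpM2l //; lra.
Qed.

End Ties.

(** * Minimum assignments of a fixed matrix *)

Section MinAssignment.
Context {R : realType} {m n : nat}.
Implicit Types (X : 'M[R]_(m, n)) (S : {set 'I_m * 'I_n}).

Lemma min_assignment_ge0 k X : (k <= m)%N -> (k <= n)%N ->
  (forall i j, 0 <= X i j) -> 0 <= min_assignment k X.
Proof.
move=> lekm lekn X_ge0; have [[S _ <-] _] := min_assignmentP X lekm lekn.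
exact: sumr_ge0.
Qed.

(** [S0] serves all matrices at once, so the minimum is a finite fold of [Num.min], from which
    measurability follows. *)
Lemma min_assignment_bigmin k : (k <= m)%N -> (k <= n)%N ->
  exists S0 : {set 'I_m * 'I_n}, forall X, min_assignment k X
    = \big[Num.min/assignment_value X S0]_(S | is_assignment k S)
        assignment_value X S.
Proof.
move=> lekm lekn.
have [[S0 S0k _] _] := min_assignmentP (0 : 'M[R]_(m, n)) lekm lekn.
exists S0 => X; have [[S Sk <-] minS] := min_assignmentP X lekm lekn.
apply/eqP; rewrite eq_le bigmin_le_cond // andbT.
by rewrite le_bigmin ?minS.
Qed.

Lemma is_assignmentP k S : is_assignment k S ->
  [/\ #|S| = k, {in S &, injective fst} & {in S &, injective snd}].
Proof.
case/andP=> /eqP cS /'forall_implyP asgn.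
have neq e f : e \in S -> f \in S -> e != f -> (e.1 != f.1) && (e.2 != f.2).
  by move=> eS fS; apply/implyP; have /'forall_implyP := asgn e eS; apply.
split=> // e f eS fS eqef; apply/eqP; apply: contraTT isT => nef;
  by have := neq e f eS fS nef; rewrite eqef eqxx ?andbF.
Qed.

(** Without ties the minimum assignment is unique. It occupies k rows and k columns, so just one k
    by k submatrix contains it. *)
Lemma sum_chi k X : (k <= m)%N -> (k <= n)%N ->
  (forall S S', is_assignment k S -> is_assignment k S' -> S != S' ->
     assignment_value X S != assignment_value X S') ->
  \sum_(I : {set 'I_m} | #|I| == k) \sum_(J : {set 'I_n} | #|J| == k)
    chi k I J X = 1.
Proof.
move=> lekm lekn noties; have [[S Sk minS] _] := min_assignmentP X lekm lekn.
have [cS inj1 inj2] := is_assignmentP Sk.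
have cI : #|(fst @: S)%SET| = k by rewrite card_in_imset.
have cJ : #|(snd @: S)%SET| = k by rewrite card_in_imset.
have SP S' : is_min_assignment k X S' -> S' = S.
  case/andP=> S'k /eqP minS'; apply/eqP; apply: contraTT isT => neS.
  by have := noties _ _ S'k Sk neS; rewrite minS minS' eqxx.
have chiE (I : {set 'I_m}) (J : {set 'I_n}) : #|I| = k -> #|J| = k ->
    chi k I J X = ((I == fst @: S) && (J == snd @: S))%SET%:R.
  move=> kI kJ; rewrite /chi; congr (_%:R); congr nat_of_bool.
  apply/existsP/andP
    => [[S' /andP[/SP -> /fintype.subsetP SIJ]]|[/eqP -> /eqP ->]].
    split; rewrite eq_sym eqEcard ?cI ?cJ ?kI ?kJ leqnn andbT.
      apply/fintype.subsetP=> _ /imsetP[e eS ->].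
      by have := SIJ e eS; rewrite inE => /andP[].
    apply/fintype.subsetP=> _ /imsetP[e eS ->].
    by have := SIJ e eS; rewrite inE => /andP[].
  exists S; rewrite /is_min_assignment Sk minS eqxx /=.
  by apply/fintype.subsetP=> e eS; rewrite inE !imset_f.
rewrite (bigD1 (fst @: S)%SET) ?cI //= (bigD1 (snd @: S)%SET) ?cJ //=.
rewrite chiE // !eqxx big1 => [|J /andP[/eqP kJ neJ]]; last first.
  by rewrite chiE // (negbTE neJ) andbF.
rewrite big1 ?addr0 // => I /andP[/eqP kI neI]; rewrite big1 // => J /eqP kJ.
by rewrite chiE // (negbTE neI).
Qed.

End MinAssignment.

(** * Measurability, almost sure uniqueness and the decomposition of the expectation *)

Section RandomAssignments.
Context {d : measure_display} {T : measurableType d} {R : realType}.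
Context (P : probability T R) {m n : nat}.
Context (X : 'I_m -> 'I_n -> {RV P >-> R}).

Lemma measurable_assignment_value (S : {set 'I_m * 'I_n}) :
  measurable_fun setT (fun w => assignment_value (realization X w) S).
Proof.
have -> : (fun w => assignment_value (realization X w) S)
    = (fun w => \sum_(e <- enum S) X e.1 e.2 w).
  apply/funext => w; rewrite big_enum /=.
  by apply: eq_bigr => e _; rewrite mxE.
exact: measurable_sum.
Qed.

Lemma measurable_bigmin (I : Type) (s : seq I) (Q : pred I) (f0 : T -> R)
    (f : I -> T -> R) :
  measurable_fun setT f0 -> (forall i, measurable_fun setT (f i)) ->
  measurable_fun setT (fun w => \big[Num.min/f0 w]_(i <- s | Q i) f i w).
Proof.
move=> mf0 mf; elim: s => [|i s IH]; first by under eq_fun do rewrite big_nil.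
under eq_fun do rewrite big_cons; case: (Q i) => //.
exact: measurable_minr.
Qed.

Lemma measurable_min_assignment k : (k <= m)%N -> (k <= n)%N ->
  measurable_fun setT (fun w => min_assignment k (realization X w)).
Proof.
move=> lekm lekn; have [S0 minE] := @min_assignment_bigmin R m n k lekm lekn.
under eq_fun do rewrite minE.
by apply: measurable_bigmin => [|S]; apply: measurable_assignment_value.
Qed.

Lemma measurable_exists (I : finType) (b : I -> T -> bool) :
  (forall i, measurable_fun setT (b i)) ->
  measurable_fun setT (fun w => [exists i, b i w]).
Proof.
move=> mb.
have -> : (fun w => [exists i, b i w]) = (fun w => \big[orb/false]_i b i w).
  by apply/funext => w; rewrite big_orE.
elim: (index_enum I) => [|i s IH].
  by under eq_fun do rewrite big_nil; apply: measurable_cst.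
by under eq_fun do rewrite big_cons /=; apply: measurable_or.
Qed.

Lemma measurable_sum_cond (I : finType) (Q : pred I) (f : I -> T -> R) :
  (forall i, measurable_fun setT (f i)) ->
  measurable_fun setT (fun w => \sum_(i | Q i) f i w).
Proof.
by move=> mf; under eq_fun do rewrite -big_filter; apply: measurable_sum.
Qed.

Lemma expectation_sum_ge0 (I : finType) (Q : pred I) (f : I -> T -> R) :
  (forall i, measurable_fun setT (f i)) -> (forall i w, 0 <= f i w) ->
  'E_P[fun w => (\sum_(i | Q i) f i w)%R]%E = (\sum_(i | Q i) 'E_P[f i]%E)%E.
Proof.
move=> mf f_ge0; rewrite expectation.unlock -big_filter.
rewrite -ge0_integral_sum // => [|i|i w _]; last by rewrite lee_fin.
  by apply: eq_integral => w _; rewrite sumEFin big_filter.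
exact/measurable_EFinP.
Qed.

Lemma ae_eq_expectation (f g : T -> R) :
  measurable_fun setT f -> measurable_fun setT g ->
  (\forall w \ae P, f w = g w) -> 'E_P[f]%E = 'E_P[g]%E.
Proof.
move=> mf mg fg; rewrite expectation.unlock.
apply: ae_eq_integral => //; [exact/measurable_EFinP..|].
by apply: filterS fg => w -> _.
Qed.

Lemma measurable_chi k (I : {set 'I_m}) (J : {set 'I_n}) :
  (k <= m)%N -> (k <= n)%N ->
  measurable_fun setT (fun w => chi k I J (realization X w)).
Proof.
move=> lekm lekn; pose b w := [exists S : {set 'I_m * 'I_n},
  is_min_assignment k (realization X w) S && (S \subset finset.setX I J)].
have -> : (fun w => chi k I J (realization X w))
    = (fun w => if b w then 1 else 0 : R).
  by apply/funext => w; rewrite /chi -/(b w); case: (b w).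
apply: measurable_fun_ifT => //; apply: measurable_exists => S.
apply: measurable_and => //; apply: measurable_and => //.
apply: measurable_fun_eqr; first exact: measurable_assignment_value.
exact: measurable_min_assignment.
Qed.

Context (A : 'M[R]_(m, n)) (expX : random_exponential A X).

Lemma ae_exponential_ge0 : \forall w \ae P, forall i j, 0 <= X i j w.
Proof.
case: expX => A_gt0 distX _.
apply: filter_forall => i; apply: filter_forall => j.
exists (X i j @^-1` `]-oo, 0[)%classic; split.
- by rewrite -[X in measurable X]setTI; apply: measurable_funPT.
- have := distX i j _ (measurable_itv `]-oo, 0[).
  by rewrite exponential_prob_lt0.
- by move=> w /= /negP; rewrite -ltNge in_itv.
Qed.

Lemma ae_assignment_value_neq (S S' : {set 'I_m * 'I_n}) :
  #|S| = #|S'| -> S != S' ->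
  \forall w \ae P, assignment_value (realization X w) S
                    != assignment_value (realization X w) S'.
Proof.
case: expX => A_gt0 distX indepX cS neS.
have /fintype.subsetPn[e eS eS'] : ~~ (S \subset S').
  by apply: contra neS => SS'; rewrite eqEcard SS' cS leqnn.
(* As [e] lies in [S] but not in [S'], equality of the two values can be solved for entry [e]; these
   are the coefficients of the other entries. *)
pose z f : R := if f == e then 0 else (f \in S')%:R - (f \in S)%:R.
have ze0 : z e = 0 by rewrite /z eqxx.
apply: negligibleS (negligible_linear_tie indepX (ltW (A_gt0 e.1 e.2)) ze0 _).
  move=> w /= /negP; rewrite negbK => /eqP eqv.
  have sumE (S1 : {set 'I_m * 'I_n}) : assignment_value (realization X w) S1
      = (e \in S1)%:R * X e.1 e.2 w
        + \sum_(f | f != e) (f \in S1)%:R * X f.1 f.2 w.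
    rewrite -(bigD1 e (P := xpredT)
      (F := fun f => (f \in S1)%:R * X f.1 f.2 w)) //=.
    rewrite /assignment_value big_mkcond /=; apply: eq_bigr => f _.
    by rewrite mxE; case: (f \in S1); rewrite ?mul1r ?mul0r.
  move: eqv; rewrite !sumE eS (negbTE eS') mul1r mul0r add0r => /eqP.
  rewrite eq_sym -subr_eq eq_sym -sumrB => /eqP ->.
  rewrite [RHS](bigD1 e) //= ze0 mul0r add0r; apply: eq_bigr => f fe.
  by rewrite /z (negbTE fe) mulrBl.
move=> x y lexy; rewrite -[leLHS]/(distribution P (X e.1 e.2) _) distX //.
exact: exponential_prob_itv_le.
Qed.

Lemma ae_sum_chi k : (k <= m)%N -> (k <= n)%N ->
  \forall w \ae P, \sum_(I : {set 'I_m} | #|I| == k)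
    \sum_(J : {set 'I_n} | #|J| == k) chi k I J (realization X w) = 1.
Proof.
move=> lekm lekn.
have : \forall w \ae P, forall S S' : {set 'I_m * 'I_n},
    #|S| = #|S'| -> S != S' -> assignment_value (realization X w) S
                    != assignment_value (realization X w) S'.
  apply: filter_forall => S; apply: filter_forall => S'.
  have [cS|ncS] := pselect (#|S| = #|S'|); last exact: aeW.
  have [eS|neS] := eqVneq S S'; first exact: aeW.
  apply: filterS (ae_assignment_value_neq cS neS) => w neq _ _; exact: neq.
apply: filterS => w noties; apply: sum_chi => // S S' Sk S'k neS.
apply: noties => //; have [-> _ _] := is_assignmentP Sk.
by have [-> _ _] := is_assignmentP S'k.
Qed.

Lemma expectation_min_assignment k l : (k <= m)%N -> (k <= n)%N ->
  (l <= m)%N -> (l <= n)%N ->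
  'E_P[fun w => min_assignment k (realization X w)]%E
  = (\sum_(I : {set 'I_m} | #|I| == l) \sum_(J : {set 'I_n} | #|J| == l)
       'E_P[fun w => (chi l I J (realization X w)
                      * min_assignment k (realization X w))%R])%E.
Proof.
move=> lekm lekn lelm leln.
pose mu w := min_assignment k (realization X w).
(* The minimum is nonnegative only almost surely. Truncation at 0 gives a function nonnegative
   everywhere, as [expectation_sum_ge0] requires. *)
pose nu w := Num.max (mu w) 0.
have m_mu : measurable_fun setT mu by exact: measurable_min_assignment.
have m_nu : measurable_fun setT nu by exact: measurable_maxr.
have ae_nu : \forall w \ae P, mu w = nu w.
  apply: filterS ae_exponential_ge0 => w X_ge0; apply/esym/max_idPl.
  by apply: min_assignment_ge0 => // i j; rewrite mxE.
pose c I J w := chi l I J (realization X w).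
have m_c I J : measurable_fun setT (c I J) by exact: measurable_chi.
have c_ge0 I J w : 0 <= c I J w by rewrite /c /chi ler0n.
have m_sum I : measurable_fun setT
    (fun w => \sum_(J : {set 'I_n} | #|J| == l) c I J w * nu w).
  exact: measurable_sum_cond (fun J => measurable_funM (m_c I J) m_nu).
transitivity ('E_P[fun w => (\sum_(I : {set 'I_m} | #|I| == l)
    \sum_(J : {set 'I_n} | #|J| == l) c I J w * nu w)%R])%E.
  apply: ae_eq_expectation => //; first exact: measurable_sum_cond.
  apply: filterS2 (ae_sum_chi lelm leln) ae_nu => w sum1 munu.
  under eq_bigr => I _ do rewrite -mulr_suml.
  by rewrite -mulr_suml sum1 mul1r.
have nu_ge0 w : 0 <= nu w by rewrite le_max lexx orbT.
rewrite expectation_sum_ge0 // => [|I w]; last first.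
  by apply: sumr_ge0 => J _; apply: mulr_ge0.
apply: eq_bigr => I _; rewrite expectation_sum_ge0 // => [|J|J w].
- apply: eq_bigr => J _; apply: ae_eq_expectation.
  + exact: measurable_funM (m_c I J) m_nu.
  + exact: measurable_funM (m_c I J) m_mu.
  + by apply: filterS ae_nu => w; rewrite -/(mu w) => ->.
- exact: measurable_funM.
- exact: mulr_ge0.
Qed.

End RandomAssignments.

Theorem mainTheorem2 (R : realType) (k m n : nat)
  (k_gt0 : (0 < k)%N) (le_k_m : (k <= m)%N) (le_m_n : (m <= n)%N) :
  (C3 R k m n -> C2 R k m n) /\ (C2 R k m n -> C1 R k m n).
Proof.
have le_k_n := leq_trans le_k_m le_m_n.
split=> [c3 r c r_gt0 c_gt0 d T P X expX|c2 d T P X expX].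
  (* Survival times link the right-hand side of C2 to the C3 sums over I and J, which are then
     matched term by term. *)
  rewrite -sum_survival_times // -sum_orderings_survival_times //.
  have [lem len] : (k - 1 <= m)%N /\ (k - 1 <= n)%N by lia.
  rewrite (expectation_min_assignment expX le_k_m le_k_n lem len).
  rewrite -sumEFin; apply: eq_bigr => I /eqP kI.
  by rewrite -sumEFin; apply: eq_bigr => J /eqP kJ; apply: c3.
rewrite -sum_survival_times_const // sum_survival_times //.
apply: c2 => //; rewrite (_ : \matrix_(i, j) _ = \matrix_(i < m, j < n) 1) //.
by apply/matrixP => i j; rewrite !mxE mulr1.
Qed.
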